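(* Let $G$ and $H$ be connected graphs. Then both $G$ and $H$ are smooth graphs if and only if the Cartesian product $G\square H$ is a smooth graph.
   Context: Graphs are simple and undirected; $d$ denotes the shortest path distance of a connected graph $G$. Intervals: $I[u,v]=\{w\in V(G): d(u,w)+d(w,v)=d(u,v)\}$; $N(u)=\{w: d(u,w)=1\}$; the step system (step function) of $G$ is $S(u,v)=I[u,v]\cap N(u)$. A connected graph $G$ is smooth if for all vertices $u,v,w,x,y$: $v\in S(u,w)$, $v\in S(u,y)$ and $x\in S(w,y)$ imply $v\in S(u,x)$. The Cartesian product $G\square H$ has vertex set $V(G)\times V(H)$, and $(g,h)$, $(g_0,h_0)$ are adjacent iff $g=g_0$ and $hh_0\in E(H)$, or $gg_0\in E(G)$ and $h=h_0$. *)

(* Defs.v *)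
From mathcomp Require Import all_boot.
From mathcomp Require Import boolp classical_sets.

Set Implicit Arguments.
Unset Strict Implicit.
Unset Printing Implicit Defensive.

Local Open Scope classical_set_scope.

(* The vertex set may be infinite. Decidability of equality and adjacency is no
   restriction, since classical logic is available. *)
Record sgraph := SGraph {
  vertex :> eqType;
  adj : rel vertex;
  adj_sym : symmetric adj;
  adj_irrefl : irreflexive adj
}.

Definition walk (G : sgraph) (u v : G) (n : nat) : Prop :=
  exists p : seq G, [/\ path (@adj G) u p, last u p = v & size p = n].

(* Connected graphs are nonempty. *)
Definition connected (G : sgraph) : Prop :=
  inhabited G /\ forall u v : G, exists n, walk u v n.

Lemma walk_asbool (G : sgraph) (u v : G) :
  (exists n, walk u v n) -> exists n, `[< walk u v n >].
Proof. by case=> n uvn; exists n; apply/asboolP. Qed.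

(* The value 0 for vertices in distinct components is a dummy: the distance is
   only meaningful in connected graphs. *)
Definition dist (G : sgraph) (u v : G) : nat :=
  if pselect (exists n, walk u v n) is left uv
  then ex_minn (walk_asbool uv) else 0.

Definition interval (G : sgraph) (u v : G) : set G :=
  [set w | dist u w + dist w v = dist u v].

Definition neighbors (G : sgraph) (u : G) : set G := [set w | dist u w = 1].

Definition step (G : sgraph) (u v : G) : set G := interval u v `&` neighbors u.

Definition smooth (G : sgraph) : Prop :=
  connected G /\
  forall u v w x y : G,
    v \in step u w -> v \in step u y -> x \in step w y -> v \in step u x.

Definition cart_adj (G H : sgraph) : rel (G * H) := fun a b =>
  ((a.1 == b.1) && adj a.2 b.2) || (adj a.1 b.1 && (a.2 == b.2)).

Lemma cart_adj_sym (G H : sgraph) : symmetric (@cart_adj G H).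
Proof.
by move=> a b; rewrite /cart_adj !(eq_sym a.1) !(eq_sym a.2) !(adj_sym a.1)
  !(adj_sym a.2).
Qed.

Lemma cart_adj_irrefl (G H : sgraph) : irreflexive (@cart_adj G H).
Proof. by move=> a; rewrite /cart_adj !adj_irrefl andbF. Qed.

Definition cart_prod (G H : sgraph) : sgraph :=
  SGraph (@cart_adj_sym G H) (@cart_adj_irrefl G H).

(* Main.v *)
Require Import Defs.
From mathcomp Require Import all_boot.
From mathcomp Require Import boolp classical_sets.
From mathcomp Require Import zify.

(** Distances add up in a Cartesian product: a walk in the product interleaves
    a walk in each factor, and conversely walks in the two factors can be
    performed one after the other ([dist_cart]).  An edge of the product moves
    exactly one coordinate, so a step from [u] towards [w] is a step in one
    factor that leaves the other coordinate fixed ([step_cart]).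

    Suppose that both factors are smooth and that [v], reached from [u] by
    moving one coordinate, lies on geodesics to [w] and to [y].  Let [x] be a
    step from [w] towards [y].  If [x] moves the same coordinate as [v],
    smoothness of that factor applies; otherwise [x] and [w] agree on that
    coordinate, and [v] is a step towards [x] because it is one towards [w].

    For the converse, each layer [G * {h}] and [{g} * H] is isometric to its
    factor and inherits its steps from the product, so it inherits smoothness
    too. *)

Set Implicit Arguments.
Unset Strict Implicit.
Unset Printing Implicit Defensive.

Section Walks.
Variable G : sgraph.
Implicit Types u v w : G.

Lemma walk_refl u : walk u u 0.
Proof. by exists [::]. Qed.

Lemma walk_cons u v w n : adj u v -> walk v w n -> walk u w n.+1.
Proof. by move=> uv [p [pP <- <-]]; exists (v :: p); split=> //=; rewrite uv. Qed.

Lemma walk_uncons u w n :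
  walk u w n.+1 -> exists2 v, adj u v & walk v w n.
Proof.
case=> [[|v p] [//= /andP[uv pP] <- [<-]]].
by exists v => //; exists p.
Qed.

Lemma walk0_eq u v : walk u v 0 -> u = v.
Proof. by case=> -[|x p] []. Qed.

Lemma walk_cat u v w m n : walk u v m -> walk v w n -> walk u w (m + n).
Proof.
case=> p [pP pl <-] [q [qP ql <-]]; exists (p ++ q); split.
- by rewrite cat_path pP pl.
- by rewrite last_cat pl.
- by rewrite size_cat.
Qed.

Lemma dist_le_walk u v n : walk u v n -> dist u v <= n.
Proof.
move=> uv; rewrite /dist; case: pselect => [ex|[]]; last by exists n.
by case: ex_minnP => m _; apply; apply/asboolP.
Qed.

Lemma walk_dist u v : connected G -> walk u v (dist u v).
Proof.
case=> _ /(_ u v) uv; rewrite /dist; case: pselect => // ex.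
by case: ex_minnP => m /asboolP.
Qed.

Lemma dist_refl u : dist u u = 0.
Proof. by apply/eqP; rewrite -leqn0; exact/dist_le_walk/walk_refl. Qed.

Lemma dist0_eq u v : connected G -> dist u v = 0 -> u = v.
Proof. by move=> cG uv; apply: walk0_eq; rewrite -uv; exact: walk_dist. Qed.

Lemma stepP u v w :
  v \in step u w <-> dist u v + dist v w = dist u w /\ dist u v = 1.
Proof. by rewrite in_setE. Qed.

Lemma step_irrefl u w : ~ u \in step u w.
Proof. by move=> /stepP[_]; rewrite dist_refl. Qed.

End Walks.

Section Product.
Variables G H : sgraph.
Implicit Types a b c : cart_prod G H.

Lemma walk_cart_fst (g g' : G) (h : H) n :
  walk g g' n -> @walk (cart_prod G H) (g, h) (g', h) n.
Proof.
elim: n g => [|n IH] g; first by move=> /walk0_eq ->; exact: walk_refl.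
case/walk_uncons=> g1 gg1 /IH; apply: walk_cons.
by rewrite /= /cart_adj /= gg1 eqxx orbT.
Qed.

Lemma walk_cart_snd (g : G) (h h' : H) n :
  walk h h' n -> @walk (cart_prod G H) (g, h) (g, h') n.
Proof.
elim: n h => [|n IH] h; first by move=> /walk0_eq ->; exact: walk_refl.
case/walk_uncons=> h1 hh1 /IH; apply: walk_cons.
by rewrite /= /cart_adj /= hh1 eqxx.
Qed.

Lemma walk_cart_split a b n : walk a b n ->
  exists n1 n2, [/\ walk a.1 b.1 n1, walk a.2 b.2 n2 & n1 + n2 = n].
Proof.
elim: n a => [|n IH] a.
  by move=> /walk0_eq ->; exists 0, 0; split=> //; exact: walk_refl.
case/walk_uncons=> c ac /IH[n1 [n2 [w1 w2 <-]]].
case/orP: ac => /andP[].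
- move=> /eqP -> a2; exists n1, n2.+1; split=> //; last by rewrite addnS.
  exact: walk_cons w2.
- move=> a1 /eqP ->; exists n1.+1, n2; split=> //.
  exact: walk_cons w1.
Qed.

Hypotheses (cG : connected G) (cH : connected H).

Lemma walk_cart a b :
  walk a b (dist a.1 b.1 + dist a.2 b.2).
Proof.
case: a b => [g h] [g' h'] /=.
apply: (@walk_cat (cart_prod G H) _ (g', h)).
- exact/walk_cart_fst/walk_dist.
- exact/walk_cart_snd/walk_dist.
Qed.

Lemma connected_cart : connected (cart_prod G H).
Proof.
split; last by move=> a b; eexists; exact: walk_cart.
by case: cG cH => -[g] _ [[h] _]; exists; exact: (g, h).
Qed.

Lemma dist_cart a b : dist a b = dist a.1 b.1 + dist a.2 b.2.
Proof.
apply/eqP; rewrite eqn_leq (dist_le_walk (walk_cart a b)) /=.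
have [n1 [n2 [w1 w2 <-]]] := walk_cart_split (walk_dist a b connected_cart).
by rewrite leq_add ?dist_le_walk.
Qed.

(** The distance 1 between [a] and [b] is a sum of two distances, so one of
    them is 0 and the other one is 1; the contribution of the fixed coordinate
    then cancels from the interval equation. *)
Lemma step_cart a b c : b \in step a c <->
  (b.1 \in step a.1 c.1 /\ b.2 = a.2) \/ (b.1 = a.1 /\ b.2 \in step a.2 c.2).
Proof.
rewrite !stepP !dist_cart; split.
- case=> ac ab.
  have [d1|d1] : dist a.1 b.1 = 0 \/ dist a.2 b.2 = 0 by lia.
  + by right; have e := dist0_eq cG d1; split=> //; move: ac ab; rewrite -e dist_refl; lia.
  + by left; have e := dist0_eq cH d1; split=> //; move: ac ab; rewrite -e dist_refl; lia.
- by case=> [[[ac ab] ->]|[-> [ac ab]]]; rewrite dist_refl; lia.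
Qed.

Lemma smooth_cart : smooth G -> smooth H -> smooth (cart_prod G H).
Proof.
move=> [_ sG] [_ sH]; split; first exact: connected_cart.
move=> u v w x y /step_cart uvw /step_cart uvy /step_cart wxy.
apply/step_cart.
(* In the mixed cases the coordinate moved towards [w] is fixed towards [y],
   against irreflexivity of steps. *)
case: uvw => [[vw vu]|[vu vw]]; case: uvy => [[vy vu']|[vu' vy]].
- left; split=> //; case: wxy => [[xw _]|[-> _]] //; exact: sG vw vy xw.
- by move: vw; rewrite vu' => /step_irrefl.
- by move: vw; rewrite vu' => /step_irrefl.
- right; split=> //; case: wxy => [[_ ->]|[_ xw]] //; exact: sH vw vy xw.
Qed.

Lemma smooth_cart_fst : smooth (cart_prod G H) -> smooth G.
Proof.
move=> [_ sGH]; split=> // u v w x y uvw uvy wxy.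
have [[h] _] := cH.
have lift (a b c : G) : b \in step a c ->
    ((b, h) : cart_prod G H) \in step ((a, h) : cart_prod G H) (c, h).
  by move=> abc; apply/step_cart; left.
have /step_cart[[]|[_ /step_irrefl]] // :=
  sGH _ _ _ _ _ (lift _ _ _ uvw) (lift _ _ _ uvy) (lift _ _ _ wxy).
Qed.

Lemma smooth_cart_snd : smooth (cart_prod G H) -> smooth H.
Proof.
move=> [_ sGH]; split=> // u v w x y uvw uvy wxy.
have [[g] _] := cG.
have lift (a b c : H) : b \in step a c ->
    ((g, b) : cart_prod G H) \in step ((g, a) : cart_prod G H) (g, c).
  by move=> abc; apply/step_cart; right.
have /step_cart[[/step_irrefl]|[]] // :=
  sGH _ _ _ _ _ (lift _ _ _ uvw) (lift _ _ _ uvy) (lift _ _ _ wxy).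
Qed.

End Product.

Theorem theorem15 (G H : sgraph) (hG : connected G) (hH : connected H) :
  (smooth G /\ smooth H) <-> smooth (cart_prod G H).
Proof.
split=> [[sG sH]|sGH]; first exact: smooth_cart.
by split; [exact: smooth_cart_fst sGH|exact: smooth_cart_snd sGH].
Qed.
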